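(* Let $\mathbb{F}$ be an infinite field and $T\in U\otimes V\otimes W$ a semistable tensor with $\dim U=n\leq m=\dim V$ and $\dim W=k$. Then for every integer $p$ with $1\leq p\leq m/n$, \[ T\geq\left\langle1,\left\lceil\frac{(m-(p-1)n)\,n}{n+m}\right\rceil,p\right\rangle. \]
   Context: $S\geq T$ means $T=(A\otimes B\otimes C)S$ for linear maps $A,B,C$ between the respective modes. $\langle E,H,L\rangle=\sum_{i\in[E],j\in[H],l\in[L]}x_{ij}y_{jl}z_{li}$. Semistability: choosing a basis $z_1,\dots,z_k$ of $W$ and writing $T=\sum_l T_l\otimes z_l$ with $T_l\in U\otimes V$, view each $T_l$ as a linear map $U\to V$. For a nonzero subspace $U^*\subseteq U$ let $T(U^* )=\sum_l T_l(U^* )\subseteq V$. $T$ is semistable if for every subspace $U'\subseteq U$ and $V'\subseteq V$ with $T_l(U')\subseteq V'$ for all $l$ and $U'\neq0$, one has $\dim U'/\dim V'\leq n/m$ (with $\dim U'/0=\infty$); equivalently, $\dim T(U^* )\geq (m/n)\dim U^*$ for every subspace $U^*\subseteq U$. *)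

(* Defs.v *)
From mathcomp Require Import all_boot all_order all_algebra.

Set Implicit Arguments.
Unset Strict Implicit.
Unset Printing Implicit Defensive.

Import Order.TTheory GRing.Theory Num.Theory.
Local Open Scope ring_scope.

(* A tensor of F^n (x) F^m (x) F^k is given by its slices along the standard
   basis z_1, ..., z_k of the third factor: T = \sum_l T_l (x) z_l, where
   T l : 'M_(n, m) is an element of F^n (x) F^m.  As everywhere in MathComp,
   vectors are rows: T l, viewed as a linear map F^n -> F^m, is u |-> u *m T l. *)
Notation tensor F n m k := {ffun 'I_k -> 'M[F]_(n, m)}.

(* u (x) v (x) w *)
Definition pure_tensor (F : fieldType) (n m k : nat)
    (u : 'rV[F]_n) (v : 'rV[F]_m) (w : 'rV[F]_k) : tensor F n m k :=
  [ffun l => w 0 l *: (u^T *m v)].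

(* (A (x) B (x) C) S, where A, B, C are the linear maps u |-> u *m A, etc.;
   see tensor_map_pure. *)
Definition tensor_map (F : fieldType) (n m k n' m' k' : nat)
    (A : 'M[F]_(n, n')) (B : 'M[F]_(m, m')) (C : 'M[F]_(k, k'))
    (S : tensor F n m k) : tensor F n' m' k' :=
  [ffun l' => \sum_(l < k) C l l' *: (A^T *m S l *m B)].

Lemma tensor_map_pure (F : fieldType) (n m k n' m' k' : nat)
    (A : 'M[F]_(n, n')) (B : 'M[F]_(m, m')) (C : 'M[F]_(k, k'))
    (u : 'rV[F]_n) (v : 'rV[F]_m) (w : 'rV[F]_k) :
  tensor_map A B C (pure_tensor u v w) =
  pure_tensor (u *m A) (v *m B) (w *m C).
Proof.
apply/ffunP => l'; rewrite !ffunE mxE scaler_suml; apply: eq_bigr => l _.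
by rewrite ffunE -scalemxAr -scalemxAl scalerA mulrC trmx_mul !mulmxA.
Qed.

Lemma tensor_mapD (F : fieldType) (n m k n' m' k' : nat)
    (A : 'M[F]_(n, n')) (B : 'M[F]_(m, m')) (C : 'M[F]_(k, k'))
    (S T : tensor F n m k) :
  tensor_map A B C (S + T) = tensor_map A B C S + tensor_map A B C T.
Proof.
apply/ffunP => l'; rewrite !ffunE -big_split; apply: eq_bigr => l _.
by rewrite ffunE mulmxDr mulmxDl scalerDr.
Qed.

(* S >= T *)
Definition restricts_to (F : fieldType) (n m k n' m' k' : nat)
    (S : tensor F n m k) (T : tensor F n' m' k') : Prop :=
  exists (A : 'M[F]_(n, n')) (B : 'M[F]_(m, m')) (C : 'M[F]_(k, k')),
    T = tensor_map A B C S.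

(* <e, h, l>; the basis vector x_ij of F^(e * h) is mxvec (delta_mx i j), and
   similarly for y_jl and z_li. *)
Definition matmul_tensor (F : fieldType) (e h l : nat) :
    tensor F (e * h) (h * l) (l * e) :=
  \sum_(a < e) \sum_(b < h) \sum_(c < l)
    pure_tensor (mxvec (delta_mx a b)) (mxvec (delta_mx b c))
                (mxvec (delta_mx c a)).

(* Subspaces are row spaces of square matrices.  The condition
   dim U' / dim V' <= n / m is cross-multiplied, which agrees with the
   convention dim U' / 0 = oo: for m > 0 and U' != 0 it fails if V' = 0. *)
Definition semistable (F : fieldType) (n m k : nat) (T : tensor F n m k) :
    Prop :=
  forall (U' : 'M[F]_n) (V' : 'M[F]_m),
    (forall l : 'I_k, (U' *m T l <= V')%MS) -> U' != 0 ->
    (\rank U' * m <= n * \rank V')%N.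

(* Main.v *)
(* If M is a linear combination of matrices R_l whose rank cannot be increased
   by moving along some R_l, then every R_l maps ker M into im M.  Apply this to
   the slices T_l composed with the projection modulo a subspace Q of F^m:
   semistability, tested on ker M, yields
   m (n - rank M) <= n (rank M + dim Q).  Starting from Q = 0 and successively
   adding im M_j to Q, one gets M_0, ..., M_(p-1) in the span of the slices
   such that each M_j has rank at least the ceiling r modulo
   im M_0 + ... + im M_(j-1).  A generic r-dimensional subspace U' of F^n meets
   none of the p kernels, so M_0 U', ..., M_(p-1) U' are in direct sum and each
   has dimension r: this is a restriction of T to <1, r, p>. *)
Require Import Defs.
From mathcomp Require Import all_boot all_order all_algebra.

Import Order.TTheory GRing.Theory Num.Theory.
Local Open Scope ring_scope.

Lemma exists_nonroot (F : fieldType)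
    (F_infinite : forall s : seq F, exists x : F, x \notin s) (q : {poly F}) :
  q != 0 -> exists t, ~~ root q t.
Proof.
move=> q_neq0.
have [s [s_uniq s_size]] : exists s : seq F, uniq s /\ size s = size q.
  elim: (size q) => [|d [s [s_uniq s_size]]]; first by exists [::].
  by have [x xs] := F_infinite s; exists (x :: s); rewrite /= xs s_size.
case: (boolP (all (root q) s)) => [rs | /allPn[t _ qt]]; last by exists t.
by have := max_poly_roots q_neq0 rs s_uniq; rewrite s_size ltnn.
Qed.

Lemma row_free_col_mx (F : fieldType) (r m : nat) (v : 'rV[F]_m)
    (A : 'M[F]_(r, m)) :
  row_free A -> ~~ (v <= A)%MS -> row_free (col_mx v A).
Proof.
move=> /eqP rA vA; rewrite /row_free eqn_leq rank_leq_row /= -addsmxE -{1}rA.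
have : (A < v + A)%MS by rewrite ltmxE addsmxSr addsmx_sub (negPf vA).
by rewrite ltmxErank => /andP[].
Qed.

Definition comb {F : fieldType} {n m k : nat} (R : 'I_k -> 'M[F]_(n, m))
    (w : 'rV[F]_k) := \sum_l w 0 l *: R l.

(** * Generic rank in a span of matrices over an infinite field *)

Section SliceSpan.

Variables (F : fieldType) (n m k : nat).
Hypothesis F_infinite : forall s : seq F, exists x : F, x \notin s.

(** Take [u] in the kernel of [N] with [u *m R] outside the image of [N]. Then [u *m R] and a basis
    of the image of [N] are independent, and for all but finitely many [t] a small change of them
    lies in the image of [N + t *: R]. *)
Lemma rank_increase (N R : 'M[F]_(n, m)) :
  ~~ (kermx N *m R <= N)%MS -> exists t, (\rank N < \rank (N + t *: R)%R)%N.
Proof.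
case/row_subPn=> i; rewrite row_mul; set u := row i _ => uR.
have uN : u *m N = 0 by apply/sub_kermxP; exact: row_sub.
have /submxP[A defA] : (row_base N <= N)%MS by rewrite eq_row_base.
set G := col_mx (u *m R) (row_base N).
have /row_freeP[B GB] : row_free G.
  by apply: row_free_col_mx; rewrite ?row_base_free // eq_row_base.
pose H := col_mx (0 : 'rV_m) (A *m R) *m B.
(* As [G *m B] is the identity, [q] takes the value 1 at 0, so it is a nonzero polynomial. *)
pose q := \det (map_mx polyC 1%:M + 'X *: map_mx polyC H).
have qE t : q.[t] = \det ((G + t *: col_mx 0 (A *m R)) *m B).
  rewrite -horner_evalE -det_map_mx; congr (\det _); apply/matrixP => a b.
  by rewrite mulmxDl GB -scalemxAl !mxE /= horner_evalE !hornerE.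
have q_neq0 : q != 0.
  apply: contraTneq isT => q0; have := qE 0; rewrite q0 horner0 scale0r addr0.
  by rewrite GB det1 => /eqP; rewrite eq_sym oner_eq0.
(* The factor ['X] excludes [t = 0], since [u] is divided by [t] below: [u *m N = 0] gives
   [(t^-1 *: u) *m (N + t *: R) = u *m R]. *)
have [|t] := @exists_nonroot F F_infinite (q * 'X).
  by rewrite mulf_neq0 ?polyX_eq0.
rewrite rootM negb_or rootE qE rootX => /andP[det_neq0 t_neq0]; exists t.
have defG : G + t *: col_mx 0 (A *m R) =
    col_mx (t^-1 *: u) A *m (N + t *: R).
  rewrite mul_col_mx scale_col_mx add_col_mx scaler0 addr0; congr col_mx.
    by rewrite mulmxDr -!scalemxAl uN scaler0 add0r -scalemxAr scalerA mulVf
      ?scale1r.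
  by rewrite mulmxDr -defA scalemxAr.
have : (G + t *: col_mx 0 (A *m R)) *m B \in unitmx.
  by rewrite unitmxE unitfE.
rewrite -row_free_unit defG -mulmxA => /eqP rk.
rewrite -add1n -rk; exact: leq_trans (mxrankM_maxr _ _) (mxrankM_maxl _ _).
Qed.

Lemma combM (R : 'I_k -> 'M[F]_(n, m)) (m' : nat) (P : 'M_(m, m')) w :
  comb (fun l => R l *m P) w = comb R w *m P.
Proof. by rewrite mulmx_suml; apply: eq_bigr => l _; rewrite scalemxAl. Qed.

Lemma comb_stable (R : 'I_k -> 'M[F]_(n, m)) :
  exists w, forall l, (kermx (comb R w) *m R l <= comb R w)%MS.
Proof.
(* Induction on a bound for the corank: a slice violating the claim allows a move that raises the
   rank, and at corank 0 the kernel is zero. *)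
suff step d w : (n - \rank (comb R w) <= d)%N ->
    exists w, forall l, (kermx (comb R w) *m R l <= comb R w)%MS.
  exact: (step n 0 (leq_subr _ _)).
elim: d w => [|d IHd] w hd; last first.
  have [/forallP | /forallPn[l /rank_increase[t]]] :=
    boolP [forall l, kermx (comb R w) *m R l <= comb R w]%MS.
    by exists w.
  have -> : comb R w + t *: R l = comb R (w + t *: delta_mx 0 l).
    transitivity (\sum_i (w 0 i *: R i + (t *+ (i == l)) *: R i)).
      rewrite big_split [X in _ = _ + X](bigD1 l) //= eqxx mulr1n.
      rewrite [X in _ = _ + (_ + X)]big1 ?addr0 // => i /negPf->.
      by rewrite mulr0n scale0r.
    apply: eq_bigr => i _; rewrite [in RHS]mxE -scalerDl mxE mxE.
    by rewrite eqxx mulr_natr.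
  move=> lt_rk; apply: (IHd (w + t *: delta_mx 0 l)).
  rewrite -ltnS (leq_trans _ hd) // ltn_sub2l //.
  by rewrite (leq_trans lt_rk) // rank_leq_row.
exists w => l; have : kermx (comb R w) == 0.
  by rewrite -mxrank_eq0 mxrank_ker -leqn0.
by move/eqP->; rewrite mul0mx sub0mx.
Qed.

Lemma common_row_free (I : finType) (r : nat) (X : I -> 'M[F]_(n, m)) :
  (forall i, (r <= \rank (X i))%N) ->
  exists A : 'M_(r, n), forall i, row_free (A *m X i).
Proof.
have avoid (Y : I -> 'M[F]_(n, m)) : (forall i, Y i != 0) ->
    exists v : 'rV_n, forall i, v *m Y i != 0.
  move=> Y0; pose q (c : 'I_m) i := rVpoly (col c (Y i))^T.
  have /fin_all_exists[c q0] i : exists c, q c i != 0.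
    have /matrix0Pn[a [c Yac]] := Y0 i; exists c.
    apply: contraNneq Yac => /(congr1 (fun f : {poly F} => f`_a)).
    by rewrite coef_rVpoly_ord coef0 !mxE => ->.
  have [|t] := @exists_nonroot F F_infinite (\prod_i q (c i) i).
    by apply/prodf_neq0.
  (* A vector on the moment curve: pairing with it evaluates a polynomial. *)
  move=> qt; exists (\row_(a < n) t ^+ a) => i; apply: contraNneq qt => vY.
  rewrite /root horner_prod; apply/prodf_eq0; exists i => //.
  rewrite (@horner_coef_wide _ n) ?size_poly //; apply/eqP.
  move/matrixP/(_ 0 (c i)): vY; rewrite !mxE => vY0.
  rewrite -[RHS]vY0; apply: eq_bigr => a _.
  by rewrite coef_rVpoly_ord !mxE mulrC.
elim: r => [|r IHr] rX.
  by exists 0 => i; rewrite /row_free -leqn0 rank_leq_row.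
have [i|A AX] := IHr; first exact: ltnW.
(* The image of [A *m X i] has dimension at most [r], less than the rank of [X i], so [X i] is
   nonzero modulo it. *)
have [i|v vX] := avoid (fun i => X i *m cokermx (A *m X i)).
  rewrite -submxE; apply: contraL (rX i) => /mxrankS.
  by rewrite -leqNgt (eqP (AX i)).
exists (col_mx v A) => i.
rewrite -[row_free _]/(row_free ((col_mx v A : 'M_(1 + r, n)) *m X i)).
rewrite mul_col_mx.
apply: row_free_col_mx => //.
by rewrite submxE -mulmxA.
Qed.

End SliceSpan.

(** Indexing [w] by all of [nat] lets a sequence be extended without changing its type; only its
    first [j] entries matter. *)
Definition flag {F : fieldType} {n m k : nat} (R : 'I_k -> 'M[F]_(n, m))
    (w : nat -> 'rV[F]_k) (j : nat) : 'M[F]_m :=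
  (\sum_(i < j) <<comb R (w i)>>)%MS.

(** * Semistability and the successive choice of combinations of slices *)

Section Semistable.

Variables (F : fieldType) (n m k : nat) (T : tensor F n m k).
Hypothesis F_infinite : forall s : seq F, exists x : F, x \notin s.
Hypothesis T_semistable : semistable T.

Lemma large_rank_mod (Q : 'M[F]_m) :
  exists w, let r := \rank (comb T w *m cokermx Q) in
    (n * m <= r * (n + m) + n * \rank Q)%N.
Proof.
have [w stab] := @comb_stable F n m k F_infinite (fun l => T l *m cokermx Q).
rewrite combM in stab; exists w => /=; set N := _ *m _ in stab *.
have rk_sum : (\rank (Q + comb T w) <= \rank N + \rank Q)%N.
  rewrite -(mxrank_mul_ker _ (cokermx Q)) leq_add //.
    by rewrite (eqmxMr _ (addsmxE _ _)) mul_col_mx mulmx_coker -addsmxE adds0mx.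
  rewrite mxrankS // submxE; apply/eqP/sub_kermxP; exact: capmxSr.
(* Semistability says nothing about the zero subspace; in that case [N] has rank [n] and the bound
   is immediate. *)
have [ker0|ker_neq0] := eqVneq (kermx N) 0.
  have := mxrank_ker N; rewrite ker0 mxrank0 => /esym/eqP; rewrite subn_eq0 => h.
  by rewrite mulnDr -addnA (leq_trans _ (leq_addl _ _)) //
    (leq_trans _ (leq_addr _ _)) // leq_mul2r h orbT.
have := T_semistable (kermx N) (Q + comb T w)%MS _ ker_neq0.
rewrite mxrank_ker => h; have {}h := leq_trans (h _) (leq_mul (leqnn n) rk_sum).
have : ((n - \rank N) * m <= n * (\rank N + \rank Q))%N.
  (* Stability modulo [Q] lifts: each [T l] maps the kernel of [N] into [Q + comb T w]. *)
  apply: h => l; have := stab l; rewrite mulmxA => /submxP[D defD].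
  have : (kermx N *m T l - D *m comb T w <= Q)%MS.
    by rewrite submxE mulmxBl defD mulmxA subrr.
  move=> hQ; rewrite -[X in (X <= _)%MS](subrK (D *m comb T w)).
  by rewrite addmx_sub_adds // submxMl.
rewrite mulnBl leq_subLR => /leq_trans; apply.
by rewrite !mulnDr addnA [(_ * n)%N]mulnC [X in (X + _)%N]addnC.
Qed.

Lemma flag_rank w j : (\rank (flag T w j) <= j * n)%N.
Proof.
elim: j => [|j IHj]; first by rewrite /flag big_ord0 mxrank0.
rewrite /flag big_ord_recr /= mulSn addnC.
rewrite (leq_trans (mxrank_adds_leqif _ _)) // leq_add //.
by rewrite genmxE rank_leq_row.
Qed.

Lemma eq_flag (w w' : nat -> 'rV[F]_k) j :
  (forall i, (i < j)%N -> w i = w' i) -> flag T w j = flag T w' j.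
Proof. by move=> ww'; apply: eq_bigr => i _; rewrite ww'. Qed.

Lemma flag_sub w i j : (i < j)%N -> (comb T (w i) <= flag T w j)%MS.
Proof.
by move=> ij; rewrite (sumsmx_sup (Ordinal ij)) // genmxE.
Qed.

(** For every [j < p] the flag has dimension at most [p.-1 * n], so this worst case gives one [r]
    valid at all steps. *)
Lemma flag_exists (p r : nat) :
    (forall r', n * m <= r' * (n + m) + n * (p.-1 * n) -> r <= r')%N ->
  exists w, forall j, (j < p)%N ->
    (r <= \rank (comb T (w j) *m cokermx (flag T w j)))%N.
Proof.
(* The inequality with the true rank of the flag does not involve [r], whose hypothesis depends on
   [p]; this makes induction on [p] possible. *)
move=> hr; suff [w hw] : exists w, forall j, (j < p)%N ->
    (n * m <= \rank (comb T (w j) *m cokermx (flag T w j)) * (n + m)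
              + n * \rank (flag T w j))%N.
  exists w => j jp; apply: hr; rewrite (leq_trans (hw j jp)) // leq_add2l.
  rewrite leq_mul2l (leq_trans (flag_rank w j)) ?orbT // leq_mul2r.
  by rewrite -ltnS prednK ?jp ?orbT // (leq_ltn_trans _ jp).
elim: {hr} p => [|p [w IHp]]; first by exists (fun _ => 0).
have [v hv] := large_rank_mod (flag T w p).
pose w' i := if i == p then v else w i.
have w'E j : (j <= p)%N -> flag T w' j = flag T w j.
  move=> jp; apply: eq_flag => i ij; rewrite /w' ltn_eqF //.
  exact: leq_trans ij jp.
exists w' => j; rewrite ltnS leq_eqVlt => /orP[/eqP->|jp].
  by rewrite w'E // /w' eqxx.
by rewrite w'E ?(ltnW jp) // /w' (ltn_eqF jp) IHp.
Qed.

(** The system is triangular: modulo the flag at the last index only the last term of the sum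
    survives, which forces its coefficient to vanish. *)
Lemma flag_direct w (r p : nat) (A : 'M[F]_(r, n)) (y : nat -> 'rV[F]_r) :
  (forall j, (j < p)%N ->
     row_free (A *m (comb T (w j) *m cokermx (flag T w j)))) ->
  \sum_(j < p) y j *m (A *m comb T (w j)) = 0 ->
  forall j, (j < p)%N -> y j = 0.
Proof.
elim: p => [//|p IHp] Afree; rewrite big_ord_recr /= => sum0.
have yp0 : y p = 0.
  have := congr1 (mulmx^~ (cokermx (flag T w p))) sum0.
  rewrite mul0mx mulmxDl mulmx_suml big1 ?add0r => [|i _].
    rewrite -!mulmxA.
    rewrite -[RHS](mul0mx _ (A *m (comb T (w p) *m cokermx (flag T w p)))).
    by move/(row_free_inj (Afree p (leqnn _))).
  apply/eqP; rewrite -submxE mulmxA (submx_trans (submxMl _ _)) //.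
  exact: flag_sub.
rewrite yp0 mul0mx addr0 in sum0 => j; rewrite ltnS leq_eqVlt.
case/orP=> [/eqP->//|jp]; apply: IHp => // i ip.
by apply: Afree; exact: leqW.
Qed.

(** * Restriction to the matrix multiplication tensor *)

Lemma matmul_slice (r p : nat) c a :
  matmul_tensor F 1 r p (mxvec_index c a) =
  \sum_(b < r) (mxvec (delta_mx 0 b))^T *m mxvec (delta_mx b c).
Proof.
rewrite /matmul_tensor sum_ffunE big_ord1 sum_ffunE.
apply: eq_bigr => b _; rewrite sum_ffunE (bigD1 c) //= big1 => [|i ic].
  by rewrite ffunE mxvecE mxE eqxx ord1 scale1r addr0.
by rewrite ffunE mxvecE mxE [c == _]eq_sym (negPf ic) scale0r.
Qed.

Lemma restricts_to_matmul (r p : nat) (A : 'M[F]_(r, n))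
    (w : 'I_p -> 'rV[F]_k) :
  (forall y : 'I_p -> 'rV[F]_r,
     \sum_j y j *m (A *m comb T (w j)) = 0 -> forall j, y j = 0) ->
  restricts_to T (matmul_tensor F 1 r p).
Proof.
move=> direct.
(* [Z] sends the basis vector with index [(b, c)] to [row b A *m comb T (w c)]. Directness makes it
   injective, and its right inverse [B] is the map on the second factor. *)
pose Z : 'M[F]_(r * p, m) := \sum_b \sum_c
  (mxvec (delta_mx b c))^T *m row b (A *m comb T (w c)).
have mulZ (Y : 'M_(r, p)) :
    mxvec Y *m Z = \sum_c (col c Y)^T *m (A *m comb T (w c)).
  rewrite mulmx_sumr; under [RHS]eq_bigr => c _ do rewrite mulmx_sum_row.
  rewrite exchange_big /=; apply: eq_bigr => b _.
  rewrite mulmx_sumr; apply: eq_bigr => c _.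
  rewrite mulmxA.
  have -> : mxvec Y *m (mxvec (delta_mx b c))^T = (Y b c)%:M.
    rewrite [LHS]mx11_scalar; congr _%:M.
    rewrite mxE (bigD1 (mxvec_index b c)) //= big1 => [|x].
      by rewrite mxE !mxvecE mxE !eqxx mulr1 addr0.
    case/mxvec_indexP: x => b' c' ne; rewrite mxE !mxvecE mxE.
    case: andP => [[/eqP eb /eqP ec]|]; last by rewrite mulr0.
    by rewrite eb ec eqxx in ne.
  by rewrite mul_scalar_mx !mxE.
have mulZd b c : mxvec (delta_mx b c) *m Z = row b A *m comb T (w c).
  rewrite mulZ (bigD1 c) //= big1 ?addr0 => [|c' ne].
    rewrite mulmxA rowE; congr (_ *m _ *m _); apply/rowP => i.
    by rewrite !mxE eqxx andbT eqxx.
  suff -> : (col c' (delta_mx b c))^T = 0 :> 'rV[F]_r by rewrite mul0mx.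
  by apply/rowP => i; rewrite !mxE (negPf ne) andbF.
have /row_freeP[B ZB] : row_free Z.
  apply: inj_row_free => v; rewrite -[v]vec_mxK mulZ => sum0.
  rewrite [vec_mx v](_ : _ = 0) ?linear0 //.
  apply/matrixP => b c; move/rowP/(_ b): (direct _ sum0 c).
  by rewrite !mxE.
(* [U] has the rows of [A] as its rows, and [C] has the vectors [w c] as its columns. *)
pose U := \sum_b (mxvec (delta_mx (0 : 'I_1) b))^T *m row b A.
pose C := \sum_c (w c)^T *m mxvec (delta_mx c (0 : 'I_1)).
exists U^T, B, C; apply/ffunP => x; case/mxvec_indexP: x => c a.
rewrite matmul_slice ffunE trmxK.
have -> : \sum_l C l (mxvec_index c a) *: (U *m T l *m B) =
    U *m comb T (w c) *m B.
  rewrite mulmx_sumr mulmx_suml; apply: eq_bigr => l _.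
  rewrite -scalemxAr -scalemxAl; congr (_ *: _).
  rewrite summxE (bigD1 c) //= big1 ?addr0 => [|c' ne].
    by rewrite mxE big_ord1 mxvecE !mxE [a]ord1 !eqxx mulr1.
  by rewrite mxE big_ord1 mxvecE !mxE [c == _]eq_sym (negPf ne) mulr0.
rewrite !mulmx_suml; apply: eq_bigr => b _.
by rewrite -!mulmxA [row b A *m _]mulmxA -mulZd -mulmxA ZB mulmx1.
Qed.

End Semistable.

(** * The ceiling and the conclusion *)

Lemma ceil_bound (n m p : nat) :
    (1 <= p)%N -> (p%:R <= m%:R / n%:R :> rat) ->
  forall r', (n * m <= r' * (n + m) + n * (p.-1 * n))%N ->
  (absz (Num.ceil ((m%:R - (p%:R - 1) * n%:R) * n%:R / (n%:R + m%:R) : rat))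
     <= r')%N.
Proof.
move=> p_ge1 p_le r' hr'.
(* Division by zero gives 0 in [rat], so [n = 0] would force [p <= 0]. *)
have n_gt0 : (0 < n)%N.
  by case: n p_le {hr'} => [|//]; rewrite invr0 mulr0 lern0 eqn0Ngt p_ge1.
have n0 : 0 < n%:R :> rat by rewrite ltr0n.
have nm0 : 0 < n%:R + m%:R :> rat by rewrite -natrD ltr0n addn_gt0 n_gt0.
have p1 : (p%:R - 1 = p.-1%:R :> rat) by rewrite -subn1 natrB.
set q := _ / _; have q_le : Num.ceil q <= r'%:Z.
  rewrite ceil_le_int -[leRHS]/(r'%:R) ler_pdivrMr // p1 mulrBl lerBlDr.
  rewrite -!(natrD, natrM) ler_nat mulnC.
  by rewrite (leq_trans hr') // leq_add2l mulnC.
(* [absz] is harmless only on a nonnegative ceiling; here [p <= m / n] gives [(p - 1) * n <= m]. *)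
suff : 0 <= Num.ceil q by move=> c0; rewrite -lez_nat gez0_abs.
rewrite ceil_ge0 (lt_le_trans (ltrN10 _)) //.
rewrite divr_ge0 ?(ltW nm0) // mulr_ge0 ?ler0n // subr_ge0.
by rewrite -ler_pdivlMr // (le_trans _ p_le) // lerBlDr lerDl ler01.
Qed.

Theorem theorem6p2 (F : fieldType)
    (F_infinite : forall s : seq F, exists x : F, x \notin s)
    (n m k : nat) (le_nm : (n <= m)%N)
    (T : tensor F n m k) (T_semistable : semistable T)
    (p : nat) (p_ge1 : (1 <= p)%N) (p_le : (p%:R <= m%:R / n%:R :> rat)) :
  restricts_to T
    (matmul_tensor F 1
       (absz (Num.ceil ((m%:R - (p%:R - 1) * n%:R) * n%:R / (n%:R + m%:R) : rat)))
       p).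
Proof.
have := @ceil_bound n m p p_ge1 p_le; set r := absz _ => hr.
have [w hw] := @flag_exists F n m k T F_infinite T_semistable p r hr.
have [//|A hA] := @common_row_free F n m F_infinite 'I_p r
  (fun j => comb T (w j) *m cokermx (flag T w j)) _.
  by move=> j; apply: hw.
apply: (@restricts_to_matmul F n m k T r p A (fun j => w j)) => y sum0 j.
(* Extension by 0 to all of [nat], the index type in [flag_direct]. *)
pose y' i := if insub i is Some j then y j else 0.
have y'E (i : 'I_p) : y' i = y i by rewrite /y' valK.
rewrite -y'E; apply: (@flag_direct F n m k T w r p A) (ltn_ord j) => [i ip|].
  exact: (hA (Ordinal ip)).
by rewrite -[RHS]sum0; apply: eq_bigr => i _; rewrite y'E.
Qed.
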